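(* The lattice $\mathsf{A}_{\{3\}}(4)$ does not satisfy the lattice identity $(\mathrm{Veg}_1)$, and the lattice $\mathsf{A}_{\{2\}}(4)$ does not satisfy the dual of the identity $(\mathrm{Veg}_1)$. In particular, neither $\mathsf{A}_{\{3\}}(4)$ nor $\mathsf{A}_{\{2\}}(4)$ can be embedded (as a lattice) into any Tamari lattice $\mathsf{A}(\ell)$ ($\ell$ a positive integer).
   Context: Notation: $[n]=\{1,\dots,n\}$ and $\mathcal{I}_n=\{(i,j)\in[n]\times[n] : i<j\}$. For a positive integer $n$ and $U\subseteq[n]$, $\mathsf{A}_U(n)$ is the set of all subsets $\boldsymbol{a}\subseteq\mathcal{I}_n$ that are transitive as binary relations and such that, whenever $1\le i<j<k\le n$ and $(i,k)\in\boldsymbol{a}$: $(i,j)\in\boldsymbol{a}$ if $j\in U$, and $(j,k)\in\boldsymbol{a}$ if $j\notin U$. It is ordered by inclusion and is a lattice. The Tamari lattice is $\mathsf{A}(n)=\mathsf{A}_{[n]}(n)$. A lattice embedding is an injective map preserving binary meets and joins. A lattice satisfies an identity if it holds for every assignment of elements of the lattice to the variables. The dual of an identity $u\le v$ is obtained by exchanging $\vee$ and $\wedge$ and reversing the inequality. The identity $(\mathrm{Veg}_1)$, in the variables $\mathsf a_1,\mathsf a_2,\mathsf b_1,\mathsf b_2$, is $$(\mathsf a_1\vee\mathsf b_1)\wedge(\mathsf a_2\vee\mathsf b_2)\le\bigl((\mathsf a_1\vee\mathsf b_1)\wedge(\mathsf a_1\vee\tilde{\mathsf b}_2)\bigr)\vee\bigl((\mathsf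 a_2\vee\tilde{\mathsf b}_1)\wedge(\mathsf a_2\vee\mathsf b_2)\bigr),$$ where $\tilde{\mathsf b}_i=(\mathsf b_1\vee\mathsf b_2)\wedge(\mathsf a_i\vee\mathsf b_i)$ for $i\in\{1,2\}$. *)

(* Defs.v *)
From HB Require Import structures.
From mathcomp Require Import all_boot all_order.

Set Implicit Arguments.
Unset Strict Implicit.
Unset Printing Implicit Defensive.

Import Order.Theory.

(* The set {1, ..., n} is represented by 'I_n: the ordinal of value i stands   *)
(* for the integer i.+1.                                                       *)

Definition ltpairs (n : nat) : {set 'I_n * 'I_n} :=
  [set p : 'I_n * 'I_n | p.1 < p.2].

Definition transitive_set (n : nat) (a : {set 'I_n * 'I_n}) : bool :=
  [forall i, forall j, forall k,
    ((i, j) \in a) && ((j, k) \in a) ==> ((i, k) \in a)].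

Definition U_closed (n : nat) (U : {set 'I_n}) (a : {set 'I_n * 'I_n}) : bool :=
  [forall i : 'I_n, forall j : 'I_n, forall k : 'I_n,
    [&& i < j, j < k & (i, k) \in a] ==>
      (if j \in U then (i, j) \in a else (j, k) \in a)].

Definition isA (n : nat) (U : {set 'I_n}) (a : {set 'I_n * 'I_n}) : bool :=
  [&& a \subset ltpairs n, transitive_set a & U_closed U a].

Record A (n : nat) (U : {set 'I_n}) :=
  MkA { A_val :> {set 'I_n * 'I_n}; _ : isA U A_val }.

HB.instance Definition _ (n : nat) (U : {set 'I_n}) :=
  [isSub for @A_val n U].
HB.instance Definition _ (n : nat) (U : {set 'I_n}) :=
  [Finite of A U by <:].

Definition tamari (n : nat) := A [set: 'I_n].

Section ALattice.
Variables (n : nat) (U : {set 'I_n}).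
Implicit Types (a b c : {set 'I_n * 'I_n}) (x y z : A U).

Lemma isAP a :
  reflect [/\ forall i j, (i, j) \in a -> i < j,
              forall i j k, (i, j) \in a -> (j, k) \in a -> (i, k) \in a
            & forall i j k : 'I_n, i < j -> j < k -> (i, k) \in a ->
                if j \in U then (i, j) \in a else (j, k) \in a]
          (isA U a).
Proof.
apply: (iffP and3P) => [[sa ta ua]|[sa ta ua]]; split.
- by move=> i j /(subsetP sa); rewrite inE.
- move=> i j k ij jk; move/forallP/(_ i)/forallP/(_ j)/forallP/(_ k): ta.
  by rewrite ij jk.
- move=> i j k ij jk ik; move/forallP/(_ i)/forallP/(_ j)/forallP/(_ k): ua.
  by rewrite ij jk ik.
- by apply/subsetP => -[i j] /sa; rewrite inE.
- apply/forallP => i; apply/forallP => j; apply/forallP => k.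
  by apply/implyP => /andP[]; apply: ta.
- apply/forallP => i; apply/forallP => j; apply/forallP => k.
  by apply/implyP => /and3P[]; apply: ua.
Qed.

Lemma isA_ltpairs : isA U (ltpairs n).
Proof.
apply/isAP; split => [i j|i j k|i j k]; rewrite !inE //=.
  exact: ltn_trans.
by move=> ij jk _; case: ifP.
Qed.

Lemma isA_setI a b : isA U a -> isA U b -> isA U (a :&: b).
Proof.
move=> /isAP[sa ta ua] /isAP[sb tb ub]; apply/isAP; split => [i j|i j k|i j k].
- by rewrite inE => /andP[/sa].
- rewrite !inE => /andP[a1 b1] /andP[a2 b2].
  by rewrite (ta _ _ _ a1 a2) (tb _ _ _ b1 b2).
- move=> ij jk; rewrite !inE => /andP[a1 b1].
  by move: (ua _ _ _ ij jk a1) (ub _ _ _ ij jk b1); case: ifP => _ -> ->.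
Qed.

(* The smallest member of A_U(n) containing a, for a a subset of ltpairs n;    *)
(* ltpairs n only matters for other a, where the family of c is empty.         *)
Definition A_hull a : {set 'I_n * 'I_n} :=
  ltpairs n :&:
  \bigcap_(c : {set 'I_n * 'I_n} | isA U c && (a \subset c)) c.

Lemma isA_hull a : isA U (A_hull a).
Proof.
apply: (big_ind (fun d : {set 'I_n * 'I_n} => isA U (ltpairs n :&: d))).
- by rewrite setIT isA_ltpairs.
- by move=> d e Ad Ae; rewrite setIIr; apply: isA_setI.
- by move=> c /andP[Ac _]; apply: isA_setI => //; apply: isA_ltpairs.
Qed.

Lemma sub_A_hull a c : a \subset ltpairs n -> isA U c ->
  (A_hull a \subset c) = (a \subset c).
Proof.
move=> sa Ac; apply/idP/idP => [|ac].
  apply: subset_trans; rewrite subsetI sa; apply/bigcapsP => d.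
  by case/andP.
by apply: subset_trans (subsetIr _ _) _; apply: bigcap_inf; rewrite Ac.
Qed.

Lemma A_valP x : isA U x. Proof. by case: x. Qed.

Definition A_le x y := A_val x \subset A_val y.
Definition A_meet x y : A U := MkA (isA_setI (A_valP x) (A_valP y)).
Definition A_join x y : A U := MkA (isA_hull (A_val x :|: A_val y)).

Fact A_le_refl : reflexive A_le. Proof. by move=> x; apply: subxx. Qed.
Fact A_le_anti : antisymmetric A_le.
Proof. by move=> x y xy; apply/val_inj/eqP; rewrite eqEsubset. Qed.
Fact A_le_trans : transitive A_le.
Proof. by move=> y x z; apply: subset_trans. Qed.
Fact A_meetP x y z : A_le x (A_meet y z) = A_le x y && A_le x z.
Proof. exact: subsetI. Qed.
Fact A_joinP x y z : A_le (A_join x y) z = A_le x z && A_le y z.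
Proof.
rewrite /A_le sub_A_hull ?A_valP ?subUset //.
by case/and3P: (A_valP x) => -> _ _; case/and3P: (A_valP y) => -> _ _.
Qed.

End ALattice.

Fact A_display : Order.disp_t. Proof. exact: (Order.Disp tt tt). Qed.

HB.instance Definition _ (n : nat) (U : {set 'I_n}) :=
  Order.Le_isPOrder.Build A_display (A U)
    (@A_le_refl n U) (@A_le_anti n U) (@A_le_trans n U).
HB.instance Definition _ (n : nat) (U : {set 'I_n}) :=
  Order.POrder_MeetJoin_isLattice.Build A_display (A U)
    (@A_meetP n U) (@A_joinP n U).

Inductive lterm (V : Type) : Type :=
  | LVar of V
  | LMeet of lterm V & lterm V
  | LJoin of lterm V & lterm V.

(* LIdent u v is the lattice identity u <= v. *)
Inductive lident (V : Type) : Type := LIdent of lterm V & lterm V.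

Fixpoint leval (V : Type) (d : Order.disp_t) (L : latticeType d) (e : V -> L)
    (t : lterm V) : L :=
  match t with
  | LVar v => e v
  | LMeet t1 t2 => Order.meet (leval e t1) (leval e t2)
  | LJoin t1 t2 => Order.join (leval e t1) (leval e t2)
  end.

Definition satisfies (V : Type) (d : Order.disp_t) (L : latticeType d)
    (I : lident V) : Prop :=
  let: LIdent u v := I in forall e : V -> L, (leval e u <= leval e v)%O.

Fixpoint dual_lterm (V : Type) (t : lterm V) : lterm V :=
  match t with
  | LVar v => LVar v
  | LMeet t1 t2 => LJoin (dual_lterm t1) (dual_lterm t2)
  | LJoin t1 t2 => LMeet (dual_lterm t1) (dual_lterm t2)
  end.

Definition dual_lident (V : Type) (I : lident V) : lident V :=
  let: LIdent u v := I in LIdent (dual_lterm v) (dual_lterm u).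

Inductive veg_var := Va1 | Va2 | Vb1 | Vb2.

Definition Veg1 : lident veg_var :=
  let a1 := LVar Va1 in let a2 := LVar Va2 in
  let b1 := LVar Vb1 in let b2 := LVar Vb2 in
  let tb1 := LMeet (LJoin b1 b2) (LJoin a1 b1) in
  let tb2 := LMeet (LJoin b1 b2) (LJoin a2 b2) in
  LIdent
    (LMeet (LJoin a1 b1) (LJoin a2 b2))
    (LJoin (LMeet (LJoin a1 b1) (LJoin a1 tb2))
           (LMeet (LJoin a2 tb1) (LJoin a2 b2))).

Definition lattice_embedding (d1 d2 : Order.disp_t)
    (L1 : latticeType d1) (L2 : latticeType d2) (f : L1 -> L2) : Prop :=
  [/\ injective f,
      {morph f : x y / Order.meet x y >-> Order.meet x y}
    & {morph f : x y / Order.join x y >-> Order.join x y}].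

Definition embeds_into (d1 d2 : Order.disp_t)
    (L1 : latticeType d1) (L2 : latticeType d2) : Prop :=
  exists f : L1 -> L2, lattice_embedding f.

(* The singleton {k} as a subset of {1, ..., n}, for 1 <= k <= n. *)
Definition single (n k : nat) : {set 'I_n} := [set i : 'I_n | i.+1 == k].

(* Main.v *)
Require Import Defs.
From HB Require Import structures.
From mathcomp Require Import all_boot all_order.

(** In the Tamari lattice, let [(i, j)] lie in the left-hand side of (Veg1).
    Walking down from [j], alternately along an [a_1, b_1]-path and an
    [a_2, b_2]-path from [i] to [j], one keeps [(u, j)] in one of the two
    [b~]'s as long as only [b]-steps are met; the first [a]-step, or reaching
    [i], yields some [w] with [(w, j)] in one of the two joinands of the
    right-hand side, and [(i, w)] is handled by induction on [j].  The dual
    identity follows since the Tamari lattice is self-dual.  In the other two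
    lattices, the pair (1, 4) of integers separates the two sides of the
    identity, for assignments found by exhaustive search. *)

Set Implicit Arguments.
Unset Strict Implicit.
Unset Printing Implicit Defensive.

Import Order.Theory.

(** * Transfer of identities along embeddings and antitone involutions *)

Lemma leval_morph (V : Type) (d1 d2 : Order.disp_t) (L1 : latticeType d1)
    (L2 : latticeType d2) (f : L1 -> L2) (e : V -> L1) (t : lterm V) :
  lattice_embedding f -> f (leval e t) = leval (f \o e) t.
Proof.
case=> _ fI fU; elim: t => //= t1 <- t2 <-; [exact: fI | exact: fU].
Qed.

Lemma satisfies_embeds (V : Type) (d1 d2 : Order.disp_t)
    (L1 : latticeType d1) (L2 : latticeType d2) (I : lident V) :
  embeds_into L1 L2 -> satisfies L2 I -> satisfies L1 I.
Proof.
case: I => u v [f Ef] H e; have := H (f \o e).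
rewrite -!leval_morph //; case: Ef => inj fI _.
(* An injective meet morphism reflects the order, as [x <= y] is an equation between meets. *)
by rewrite !leEmeet -fI => /eqP/inj ->.
Qed.

Section AntitoneInvolution.
Variables (V : Type) (d : Order.disp_t) (L : latticeType d) (f : L -> L).
Hypotheses (fK : involutive f)
  (f_anti : forall x y, (x <= y)%O -> (f y <= f x)%O).

Lemma antitone_involution_le x y : (f x <= f y)%O = (y <= x)%O.
Proof. by apply/idP/idP => /f_anti //; rewrite !fK. Qed.

Lemma antitone_involution_meet x y : f (Order.meet x y) = Order.join (f x) (f y).
Proof.
apply: le_anti; rewrite leUx !f_anti ?leIl ?leIr // andbT.
rewrite -[leRHS]fK antitone_involution_le lexI.
by rewrite -(antitone_involution_le x) -(antitone_involution_le y) fK leUl leUr.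
Qed.

Lemma antitone_involution_join x y : f (Order.join x y) = Order.meet (f x) (f y).
Proof. by apply: (can_inj fK); rewrite antitone_involution_meet !fK. Qed.

Lemma leval_dual (e : V -> L) t : f (leval e (dual_lterm t)) = leval (f \o e) t.
Proof.
elim: t => //= t1 <- t2 <-.
  exact: antitone_involution_join.
exact: antitone_involution_meet.
Qed.

(** The assignment [f \o e] turns the identity into the image under [f] of its dual, with sides
    exchanged. *)
Lemma satisfies_dual (I : lident V) : satisfies L I -> satisfies L (dual_lident I).
Proof.
by case: I => u v H e; rewrite -antitone_involution_le !leval_dual.
Qed.

End AntitoneInvolution.

Section Cambrian.
Variables (n : nat) (U : {set 'I_n}).
Implicit Types (x y : A U) (i j k : 'I_n) (p : 'I_n * 'I_n).

Lemma A_lt x i j : (i, j) \in A_val x -> i < j.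
Proof. by case/isAP: (A_valP x) => + _ _; apply. Qed.

Lemma A_trans x i j k :
  (i, j) \in A_val x -> (j, k) \in A_val x -> (i, k) \in A_val x.
Proof. by case/isAP: (A_valP x) => _ + _; apply. Qed.

Lemma in_A_meet x y p :
  (p \in A_val (Order.meet x y)) = (p \in A_val x) && (p \in A_val y).
Proof. exact: in_setI. Qed.

Lemma A_leP x y : reflect {subset A_val x <= A_val y} (x <= y)%O.
Proof. exact: subsetP. Qed.

Lemma in_A_joinl x y p : p \in A_val x -> p \in A_val (Order.join x y).
Proof. exact/A_leP/leUl. Qed.

Lemma in_A_joinr x y p : p \in A_val y -> p \in A_val (Order.join x y).
Proof. exact/A_leP/leUr. Qed.

End Cambrian.

(** * The Tamari lattice: (Veg1) and self-duality *)

Section Tamari.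
Variable n : nat.
Implicit Types (x y a b : tamari n) (i j k u w : 'I_n).

Lemma tamari_left x i j k :
  i < j -> j <= k -> (i, k) \in A_val x -> (i, j) \in A_val x.
Proof.
move=> ij; rewrite leq_eqVlt => /predU1P[/val_inj -> //|jk].
by case/isAP: (A_valP x) => _ _ /(_ _ _ _ ij jk) /[apply]; rewrite inE.
Qed.

Definition last_step_set a b : {set 'I_n * 'I_n} :=
  [set p | (p \in A_val (Order.join a b)) &&
    [forall u : 'I_n, (p.1 < u <= p.2) ==>
      [exists w : 'I_n, [&& p.1 <= w, w < u, (w, u) \in A_val a :|: A_val b
                          & (w, p.2) \in A_val (Order.join a b)]]]].

Lemma last_step_setP a b i j :
  reflect ((i, j) \in A_val (Order.join a b) /\
           forall u, i < u -> u <= j ->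
           exists w, [/\ i <= w, w < u, (w, u) \in A_val a :|: A_val b
                       & (w, j) \in A_val (Order.join a b)])
          ((i, j) \in last_step_set a b).
Proof.
rewrite /last_step_set; move: (Order.join a b) => c.
rewrite inE /=; apply: (iffP andP) => -[ij H]; split=> //.
  move=> u iu uj; move/forallP/(_ u): H; rewrite iu uj => /existsP[w].
  by case/and4P; exists w.
apply/forallP => u; apply/implyP => /andP[iu uj].
by have [w [? ? ? ?]] := H u iu uj; apply/existsP; exists w; apply/and4P.
Qed.

Lemma isA_last_step_set a b : isA [set: 'I_n] (last_step_set a b).
Proof.
apply/isAP; split=> [i j /last_step_setP[/A_lt] // | i j k | i j k ij jk].
  move=> /last_step_setP[ij Hij] /last_step_setP[jk Hjk].
  apply/last_step_setP; split=> [|u iu uk]; first exact: A_trans ij jk.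
  have [uj|ju] := leqP u j.
    have [w [? ? ? wj]] := Hij u iu uj.
    by exists w; split=> //; apply: A_trans wj jk.
  have [w [jw ? ? ?]] := Hjk u ju uk.
  by exists w; split=> //; apply: leq_trans _ jw; apply/ltnW/(A_lt ij).
move=> /last_step_setP[ik H]; rewrite inE; apply/last_step_setP.
split=> [|u iu uj]; first exact: tamari_left (ltnW jk) ik.
have [w [iw wu wab wk]] := H u iu (leq_trans uj (ltnW jk)).
exists w; split=> //; apply: tamari_left wk; last exact: ltnW.
exact: leq_trans wu uj.
Qed.

(** The pairs with this property form an element of the lattice above [a] and [b], hence above their
    join. For [u = j] this is the last step of a path from [i] to [j]. *)
Lemma tamari_join_last_step a b i j u :
  (i, j) \in A_val (Order.join a b) -> i < u -> u <= j ->
  exists w, [/\ i <= w, w < u, (w, u) \in A_val a :|: A_val b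
              & (w, j) \in A_val (Order.join a b)].
Proof.
move=> ij iu uj; pose D : tamari n := MkA (isA_last_step_set a b).
suff /A_leP/(_ _ ij)/last_step_setP[_] : (Order.join a b <= D)%O by apply.
rewrite leUx; apply/andP; split; apply/A_leP => -[k l] kl;
  apply/last_step_setP; split=> [|v kv vl].
- exact: in_A_joinl.
- exists k; split=> //; last exact: in_A_joinl.
  by rewrite inE (tamari_left kv vl kl).
- exact: in_A_joinr.
- exists k; split=> //; last exact: in_A_joinr.
  by rewrite inE (tamari_left kv vl kl) orbT.
Qed.

(* The right-hand side of Veg1 is the join of [veg_part a1 b1 a2 b2] and       *)
(* [veg_part a2 b2 a1 b1].                                                     *)
Definition veg_part a1 b1 a2 b2 : tamari n :=
  Order.meet (Order.join a1 b1)
    (Order.join a1 (Order.meet (Order.join b1 b2) (Order.join a2 b2))).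

(** Induction on the bound [m] of the current position [u]; each [b]-step exchanges the indices 1
    and 2. The case [u = j] is the start of the walk, since [(j, j)] is never a pair. *)
Lemma veg_zigzag m a1 b1 a2 b2 i j u :
    u < m -> i <= u ->
    (i, j) \in A_val (Order.join a1 b1) -> (i, j) \in A_val (Order.join a2 b2) ->
    u = j \/ (u, j) \in A_val (Order.meet (Order.join b1 b2) (Order.join a1 b1)) ->
  exists w, [/\ i <= w, w < j
    & (w, j) \in A_val (veg_part a1 b1 a2 b2)
      \/ (w, j) \in A_val (veg_part a2 b2 a1 b1)].
Proof.
elim: m a1 b1 a2 b2 u => // m IH a1 b1 a2 b2 u um iu ij1 ij2 uj.
have le_uj : u <= j by case: uj => [->|/A_lt/ltnW].
move: iu; rewrite leq_eqVlt => /predU1P[/val_inj eq_iu|iu].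
  exists i; split=> //; first exact: A_lt ij1.
  right; rewrite in_A_meet ij2 in_A_joinr //.
  case: uj => [eq_uj|]; first by have := A_lt ij1; rewrite eq_iu eq_uj ltnn.
  by rewrite (joinC b2) eq_iu.
have [w [iw wu wab wj]] := tamari_join_last_step ij2 iu le_uj.
(* An [a2]-step followed by [(u, j)] in [b~_1] puts [(w, j)] in the join of [a2] and [b~_1]. *)
case/setUP: wab => [wua|wub].
  exists w; split=> //; first exact: leq_trans wu le_uj.
  right; rewrite in_A_meet wj andTb.
  case: uj => [<-|uj]; first exact: in_A_joinl.
  apply: A_trans (in_A_joinl _ wua) _.
  by apply: in_A_joinr; rewrite (joinC b2).
(* After a [b2]-step, [(w, j)] lies in [b~_2]: the invariant with indices exchanged. *)
have wbb : (w, j) \in A_val (Order.join b2 b1).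
  case: uj => [<-|]; first exact: in_A_joinl.
  rewrite in_A_meet (joinC b1) => /andP[uj _].
  by apply: A_trans uj; apply: in_A_joinl.
have [||v [iv vj Hv]] := IH a2 b2 a1 b1 w _ iw ij2 ij1.
- by apply: leq_trans wu _.
- by right; rewrite in_A_meet wbb.
- by exists v; split=> //; case: Hv; [right | left].
Qed.

Lemma tamari_Veg1 : satisfies (tamari n) Veg1.
Proof.
move=> e; rewrite /Veg1 /=.
set a1 := e Va1; set a2 := e Va2; set b1 := e Vb1; set b2 := e Vb2.
apply/A_leP => -[i j]; move: {2}j.+1 (ltnSn j) => m.
elim: m j => // m IH j jm ij.
have := ij; rewrite in_A_meet => /andP[ij1 ij2].
have [|w [iw wj Hw]] :=
  veg_zigzag (ltnSn j) (ltnW (A_lt ij1)) ij1 ij2; first by left.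
set R := (X in _ \in A_val X).
have wR : (w, j) \in A_val R.
  case: Hw => Hw; first by apply: in_A_joinl.
  apply: in_A_joinr; rewrite meetC; move: Hw.
  by rewrite /veg_part (joinC b2).
move: iw; rewrite leq_eqVlt => /predU1P[/val_inj -> //|iw].
apply: A_trans wR; apply: IH; first exact: leq_trans wj _.
exact: tamari_left (ltnW wj) ij.
Qed.

(* In terms of binary trees with nodes numbered in infix order, [(i, j)] is in *)
(* a when j is in the right subtree of i, and this is mirror symmetry.         *)
Definition mirror_set a : {set 'I_n * 'I_n} :=
  [set p : 'I_n * 'I_n | (p.1 < p.2) &&
    [forall k : 'I_n, (p.1 < k <= p.2) ==>
      ((rev_ord k, rev_ord p.1) \notin A_val a)]].

Lemma mirror_setP a i j :
  reflect (i < j /\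
           forall k, i < k -> k <= j -> (rev_ord k, rev_ord i) \notin A_val a)
          ((i, j) \in mirror_set a).
Proof.
rewrite inE /=; apply: (iffP andP) => -[ij H]; split=> //.
  by move=> k ik kj; move/forallP/(_ k): H; rewrite ik kj.
by apply/forallP => k; apply/implyP => /andP[]; apply: H.
Qed.

Lemma ltn_rev_ord i j : (rev_ord i < rev_ord j) = (j < i).
Proof. by rewrite /= ltn_sub2lE. Qed.

Lemma leq_rev_ord i j : (rev_ord i <= rev_ord j) = (j <= i).
Proof. by rewrite leqNgt ltn_rev_ord -leqNgt. Qed.

Lemma isA_mirror_set a : isA [set: 'I_n] (mirror_set a).
Proof.
apply/isAP; split=> [i j /mirror_setP[] // | i j k | i j k ij jk].
  move=> /mirror_setP[ij Hij] /mirror_setP[jk Hjk]; apply/mirror_setP.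
  split=> [|m im mk]; first exact: ltn_trans jk.
  have [mj|jm] := leqP m j; first exact: Hij.
  apply: contra (Hjk m jm mk); apply: tamari_left; first by rewrite ltn_rev_ord.
  by rewrite leq_rev_ord ltnW.
move=> /mirror_setP[_ H]; rewrite inE; apply/mirror_setP.
by split=> // m im mj; apply: H => //; apply: leq_trans mj (ltnW jk).
Qed.

Definition mirror a : tamari n := MkA (isA_mirror_set a).

Lemma mirror_anti a b : (a <= b)%O -> (mirror b <= mirror a)%O.
Proof.
move=> /A_leP ab; apply/A_leP => -[i j] /mirror_setP[ij H].
apply/mirror_setP; split=> // k ik kj.
by apply: contra (H k ik kj); apply: ab.
Qed.

Lemma mirrorK : involutive mirror.
Proof.
move=> a; apply/val_inj/setP => -[i j]; apply/mirror_setP/idP => [[ij H]|ij].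
  (* That [(rev_ord k, rev_ord i)] is not in the mirror of [a] yields a pair [(rev_ord l, k)] of [a]
     with [i <= rev_ord l]. Iterating descends from [k] to [i], and transitivity composes the
     steps. *)
  suff K m k : k < m -> i < k -> k <= j -> (i, k) \in A_val a.
    exact: K (ltnSn j) ij (leqnn j).
  elim: m k => // m IH k km ik kj.
  have := H k ik kj; rewrite inE /= ltn_rev_ord ik /= negb_forall.
  case/existsP => l; rewrite negb_imply negbK rev_ordK => /andP[/andP[kl li] lk].
  have il : i <= rev_ord l by rewrite -[i]rev_ordK leq_rev_ord.
  move: il; rewrite leq_eqVlt => /predU1P[/val_inj -> //|il].
  have lt_lk := A_lt lk.
  apply: A_trans lk; apply: IH il _; first exact: leq_trans lt_lk _.
  exact: leq_trans (ltnW lt_lk) kj.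
split=> [|k ik kj]; first exact: A_lt ij.
(* At [rev_ord i], the mirror condition would exclude [(i, k)] from [a]. *)
apply/mirror_setP => -[_ /(_ (rev_ord i))]; rewrite ltn_rev_ord leqnn ik !rev_ordK.
by rewrite (tamari_left ik kj ij) => /(_ isT isT).
Qed.

Lemma tamari_dual_Veg1 : satisfies (tamari n) (dual_lident Veg1).
Proof. exact: satisfies_dual mirrorK mirror_anti _ tamari_Veg1. Qed.

End Tamari.

(** * The two counterexamples, by computation on explicit pairs *)

Section Explicit.
Variables (n k : nat).

Definition pair_set (s : seq (nat * nat)) : {set 'I_n * 'I_n} :=
  [set p | (val p.1, val p.2) \in s].

(** A check that evaluates on closed lists, so that [isT] certifies each explicit element. *)
Definition isA_seq (s : seq (nat * nat)) : bool :=
  all (fun p => [&& p.1 < p.2,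
    all (fun q => (p.2 == q.1) ==> ((p.1, q.2) \in s)) s &
    all (fun j => (p.1 < j < p.2) ==>
      (if j.+1 == k then (p.1, j) \in s else (j, p.2) \in s)) (iota 0 n)]) s.

Lemma isA_pair_set s : isA_seq s -> isA (single n k) (pair_set s).
Proof.
move=> /allP H; apply/isAP; split=> [i j|i j l|i j l ij jl]; rewrite !inE /=.
- by move=> /H /and3P[].
- move=> /H /and3P[_ /allP/(_ (val j, val l)) + _] => /[apply].
  by rewrite /= eqxx.
- move=> /H /and3P[_ _ /allP/(_ (val j))].
  by rewrite mem_iota /= ij jl ltn_ord => /(_ isT); case: eqP.
Qed.

Definition Aseq s (H : isA_seq s) : A (single n k) := MkA (isA_pair_set H).

Lemma in_Aseq s (H : isA_seq s) p :
  (p \in A_val (Aseq H)) = ((val p.1, val p.2) \in s).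
Proof. by rewrite inE. Qed.

Lemma le_Aseq s t (Hs : isA_seq s) (Ht : isA_seq t) :
  all (mem t) s -> (Aseq Hs <= Aseq Ht)%O.
Proof.
by move=> /allP st; apply/A_leP => p; rewrite !in_Aseq; apply: st.
Qed.

Lemma leI_Aseq s s' t (Hs : isA_seq s) (Hs' : isA_seq s') (Ht : isA_seq t) :
  all (fun p => (p \in s') ==> (p \in t)) s ->
  (Order.meet (Aseq Hs) (Aseq Hs') <= Aseq Ht)%O.
Proof.
move=> /allP st; apply/A_leP => p; rewrite in_A_meet !in_Aseq => /andP[ps].
by apply/implyP; apply: st.
Qed.

End Explicit.

Lemma A3_not_Veg1 : ~ satisfies (A (single 4 3)) Veg1.
Proof.
pose E s H : A (single 4 3) := @Aseq 4 3 s H.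
pose a1 := E [:: (0, 2); (1, 2)] isT.
pose a2 := E [:: (1, 2); (1, 3)] isT.
pose b1 := E [:: (2, 3)] isT.
pose b2 := E [:: (0, 1)] isT.
(* Upper bounds: [x], [y], [bb] for the joins of [a1, b1], of [a2, b2] and of [b1, b2]; [z1], [z2]
   for those of [a1, b~_2] and of [a2, b~_1]; [r] for the right-hand side. *)
pose x := E [:: (0, 2); (0, 3); (1, 2); (1, 3); (2, 3)] isT.
pose y := E [:: (0, 1); (0, 2); (0, 3); (1, 2); (1, 3)] isT.
pose bb := E [:: (0, 1); (2, 3)] isT.
pose z1 := E [:: (0, 1); (0, 2); (1, 2)] isT.
pose z2 := E [:: (1, 2); (1, 3); (2, 3)] isT.
pose r := E [:: (0, 2); (1, 2); (1, 3)] isT.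
pose e v := match v with Va1 => a1 | Va2 => a2 | Vb1 => b1 | Vb2 => b2 end.
have xP : (Order.join a1 b1 <= x)%O by rewrite leUx !le_Aseq.
have yP : (Order.join a2 b2 <= y)%O by rewrite leUx !le_Aseq.
have bbP : (Order.join b1 b2 <= bb)%O by rewrite leUx !le_Aseq.
move=> /(_ e) /=; set l := Order.meet _ _ => lr.
pose i k : 'I_4 := inord k.
(* The path through 2 lies in the first join, the path through 1 in the second. *)
have lP : (i 0, i 3) \in A_val l.
  rewrite in_A_meet; apply/andP; split.
    apply: (@A_trans _ _ _ _ (i 2)); [apply: in_A_joinl | apply: in_A_joinr];
      by rewrite in_Aseq /= !inordK.
  apply: (@A_trans _ _ _ _ (i 1)); [apply: in_A_joinr | apply: in_A_joinl];
    by rewrite in_Aseq /= !inordK.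
suff /A_leP/(_ _ lP) : (l <= r)%O by rewrite in_Aseq /= !inordK.
apply: (le_trans lr); rewrite leUx; apply/andP; split.
  apply: (@le_trans _ _ (Order.meet x z1)); last exact: leI_Aseq.
  apply: leI2 => //; rewrite leUx le_Aseq //.
  by apply: le_trans (leI2 bbP yP) _; apply: leI_Aseq.
apply: (@le_trans _ _ (Order.meet z2 y)); last exact: leI_Aseq.
apply: leI2 => //; rewrite leUx le_Aseq //.
by apply: le_trans (leI2 bbP xP) _; apply: leI_Aseq.
Qed.

Lemma A2_not_dual_Veg1 : ~ satisfies (A (single 4 2)) (dual_lident Veg1).
Proof.
pose E s H : A (single 4 2) := @Aseq 4 2 s H.
pose a1 := E [:: (0, 1); (0, 2); (0, 3); (2, 3)] isT.
pose a2 := E [:: (0, 1); (0, 3); (1, 3); (2, 3)] isT.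
pose b1 := E [:: (1, 2); (1, 3); (2, 3)] isT.
pose b2 := E [:: (0, 1); (0, 2); (1, 2)] isT.
(* An upper bound of the larger side of the dual identity; it omits [(0, 3)]. *)
pose l := E [:: (0, 1); (2, 3)] isT.
pose e v := match v with Va1 => a1 | Va2 => a2 | Vb1 => b1 | Vb2 => b2 end.
move=> /(_ e) /=; set r := Order.meet _ _ => rl.
pose i k : 'I_4 := inord k.
have rP : (i 0, i 3) \in A_val r.
  have E_in s H (p q : nat) : p < 4 -> q < 4 ->
      ((i p, i q) \in A_val (E s H)) = ((p, q) \in s).
    by move=> p4 q4; rewrite in_Aseq /= !inordK.
  (* Both factors contain the chain 0, 1, 2, 3 in composed form: as [(0, 2)], [(2, 3)] in the first
     and as [(0, 1)], [(1, 3)] in the second. *)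
  rewrite in_A_meet; apply/andP; split.
    apply: (@A_trans _ _ _ _ (i 2)); last first.
      by apply: in_A_joinl; rewrite in_A_meet !E_in.
    apply: in_A_joinr; rewrite in_A_meet E_in //; apply/andP; split=> //.
    apply: (@A_trans _ _ _ _ (i 1)).
      by apply: in_A_joinr; rewrite in_A_meet !E_in.
    by apply: in_A_joinl; rewrite in_A_meet !E_in.
  apply: (@A_trans _ _ _ _ (i 1)).
    by apply: in_A_joinr; rewrite in_A_meet !E_in.
  apply: in_A_joinl; rewrite in_A_meet E_in //; apply/andP; split=> //.
  apply: (@A_trans _ _ _ _ (i 2)).
    by apply: in_A_joinl; rewrite in_A_meet !E_in.
  by apply: in_A_joinr; rewrite in_A_meet !E_in.
suff /A_leP/(_ _ rP) : (r <= l)%O by rewrite in_Aseq /= !inordK.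
by apply: (le_trans rl); rewrite leUx !leI_Aseq.
Qed.

Theorem mainTheorem3 :
  [/\ ~ satisfies (A (single 4 3)) Veg1,
      ~ satisfies (A (single 4 2)) (dual_lident Veg1)
    & forall l : nat, 0 < l ->
        ~ embeds_into (A (single 4 3)) (tamari l) /\
        ~ embeds_into (A (single 4 2)) (tamari l)].
Proof.
split=> [||l _]; [exact: A3_not_Veg1 | exact: A2_not_dual_Veg1 | split=> emb].
  by apply: A3_not_Veg1; apply: satisfies_embeds emb (@tamari_Veg1 l).
by apply: A2_not_dual_Veg1; apply: satisfies_embeds emb (@tamari_dual_Veg1 l).
Qed.
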